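(* Let $S\in\mathcal{I}_1\cap\mathcal{I}_2$ be such that the shortest $s$–$t$ path in $G(S)$ has length $2(\ell+1)$, and let $\Pi_\ell=(B_1,A_1,\dots,A_\ell,B_{\ell+1})$ be a maximal augmenting set in $G(S)$. Then the exchange graph $G(S\oplus\Pi_\ell)$, where $S\oplus\Pi_\ell=S+B_1-A_1+\cdots-A_\ell+B_{\ell+1}$, contains no $s$–$t$ path of length $2(\ell+1)$.
   Context: $\mathcal{M}_1=(V,\mathcal{I}_1)$, $\mathcal{M}_2=(V,\mathcal{I}_2)$ are matroids. For $T\in\mathcal{I}_1\cap\mathcal{I}_2$, the exchange graph $G(T)$ is the directed graph on $V\cup\{s,t\}$ with arcs: $(s,a)$ for $a\notin T$ with $T+a\in\mathcal{I}_1$; $(a,t)$ for $a\notin T$ with $T+a\in\mathcal{I}_2$; $(a,b)$ for $a\in T$, $b\notin T$ with $T-a+b\in\mathcal{I}_1$; $(b,a)$ for $a\in T$, $b\notin T$ with $T-a+b\in\mathcal{I}_2$. $D_i$ is the set of elements at distance exactly $i$ from $s$ in $G(S)$. An augmenting set in $G(S)$ is a sequence $(B_1,A_1,\dots,A_\ell,B_{\ell+1})$ with: (a) $A_k\subseteq D_{2k}$, $B_k\subseteq D_{2k-1}$; (b) all sets have the same size $w$ (the width); (c) $S+B_1\in\mathcal{I}_1$; (d) $S+B_{\ell+1}\in\mathcal{I}_2$; (e) $S-A_k+B_{k+1}\in\mathcal{I}_1$ for $1\le k\le\ell$; (f) $S-A_k+B_k\in\mathcal{I}_2$ for $1\le k\le\ell$.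 An augmenting set $\Pi$ is contained in $\widetilde{\Pi}$ if each set of $\Pi$ is a subset of the corresponding set of $\widetilde{\Pi}$; $\Pi$ is maximal if no other augmenting set in $G(S)$ contains it. It is known that $S\oplus\Pi_\ell\in\mathcal{I}_1\cap\mathcal{I}_2$. *)

(* Defs.v *)
From mathcomp Require Import all_boot.

Set Implicit Arguments.
Unset Strict Implicit.
Unset Printing Implicit Defensive.

Record matroid (V : finType) := Matroid {
  indep : {set {set V}};
  indep0 : set0 \in indep;
  indepS : forall X Y : {set V}, X \subset Y -> Y \in indep -> X \in indep;
  indep_exchange : forall X Y : {set V},
    X \in indep -> Y \in indep -> #|X| < #|Y| ->
    exists2 y, y \in Y :\: X & y |: X \in indep
}.

Section Paths.

Variables (X : finType) (e : rel X).

(* Paths repeat no vertex; the length is the number of arcs. *)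
Definition has_path (u v : X) (n : nat) : bool :=
  [exists p : n.-tuple X, [&& path e u p, uniq (u :: p) & last u p == v]].

Definition at_dist (u v : X) (n : nat) : bool :=
  has_path u v n && [forall m : 'I_n, ~~ has_path u v m].

End Paths.

(* V together with the two extra vertices s = inr false and t = inr true. *)
Definition xvertex (V : finType) : finType := (V + bool)%type.

Definition src (V : finType) : xvertex V := inr false.
Definition snk (V : finType) : xvertex V := inr true.
Arguments src {V}.
Arguments snk {V}.

Section ExchangeGraph.

Variables (V : finType) (M1 M2 : matroid V).

Definition exchange_graph (T : {set V}) : rel (xvertex V) := fun u v =>
  match u, v with
  | inr false, inl a => (a \notin T) && (a |: T \in indep M1)
  | inl a, inr true => (a \notin T) && (a |: T \in indep M2)
  | inl x, inl y =>
         [&& x \in T, y \notin T & y |: (T :\ x) \in indep M1]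
      || [&& y \in T, x \notin T & x |: (T :\ y) \in indep M2]
  | _, _ => false
  end.

Definition dlayer (S : {set V}) (i : nat) : {set V} :=
  [set v : V | at_dist (exchange_graph S) src (inl v : xvertex V) i].

(* Indices are shifted to start at 0: setB P k stands for B_(k+1) and
   setA P k for A_(k+1). *)
Record set_sequence (l : nat) := SetSequence {
  setB : {ffun 'I_l.+1 -> {set V}};
  setA : {ffun 'I_l -> {set V}}
}.

(* In the last two fields, for k : 'I_l, widen_ord (leqnSn l) k is k and
   lift ord0 k is k + 1, both as elements of 'I_l.+1. *)
Record augmenting_set (S : {set V}) (l : nat) (P : set_sequence l) : Prop :=
  AugmentingSet {
  aug_layerA : forall k : 'I_l, setA P k \subset dlayer S (2 * k.+1);
  aug_layerB : forall k : 'I_l.+1, setB P k \subset dlayer S (2 * k.+1 - 1);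
  aug_width : exists w : nat,
    (forall k, #|setA P k| = w) /\ (forall k, #|setB P k| = w);
  aug_first : S :|: setB P ord0 \in indep M1;
  aug_last : S :|: setB P ord_max \in indep M2;
  aug_indep1 : forall k : 'I_l,
    (S :\: setA P k) :|: setB P (lift ord0 k) \in indep M1;
  aug_indep2 : forall k : 'I_l,
    (S :\: setA P k) :|: setB P (widen_ord (leqnSn l) k) \in indep M2
}.

Definition aug_contained (l : nat) (P Q : set_sequence l) : Prop :=
  (forall k, setB P k \subset setB Q k) /\
  (forall k, setA P k \subset setA Q k).

Definition maximal_augmenting_set (S : {set V}) (l : nat)
    (P : set_sequence l) : Prop :=
  augmenting_set S P /\
  forall Q : set_sequence l,
    augmenting_set S Q -> aug_contained P Q -> Q = P.

(* For an augmenting set the A_k lie in S and the B_k are disjoint from S, so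
   the order in which sets are added and removed is immaterial. *)
Definition augment (S : {set V}) (l : nat) (P : set_sequence l) : {set V} :=
  (S :\: \bigcup_k setA P k) :|: \bigcup_k setB P k.

End ExchangeGraph.

(* Main.v *)
(** Let d be the distance from s in G(S).  In M1, S contains a maximum
    independent subset of U_k = {v | d v >= 2k} for k >= 1, since an element of
    U_k extending S /\ U_k would be the head of an arc that jumps a layer; in
    M2 the same holds for W_k = {v | d v <= 2k}, k <= l, because t is at
    distance 2(l+1).  As all sets of P have the same size, T = S + P meets each
    U_k and each W_k in as many elements as S does, so T also spans them.  Hence
    arcs of G(T) jump no layer either, and a path s, b_1, a_1, ..., b_(l+1), t
    in G(T) satisfies d b_k = 2k - 1 and d a_k = 2k.  Now if two independent
    sets X, S both contain a maximum independent subset of U, then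
    (X \ U) + (S /\ U) is independent.  Using this for two consecutive U_k (or
    W_k) turns the independence of T - a_k + b_(k+1) into that of
    S - (A_k + a_k) + (B_(k+1) + b_(k+1)).  So adding the b_k and a_k to P gives
    a larger augmenting set, contradicting maximality. *)
Require Import Defs.
From mathcomp Require Import all_boot zify.

Set Implicit Arguments.
Unset Strict Implicit.
Unset Printing Implicit Defensive.

(** * Matroid exchange relative to a set spanned by an independent set *)

Section Matroid.

Variables (V : finType) (M : matroid V).
Implicit Types I S T U W X Y Z : {set V}.

Lemma indep_extend X Y :
  X \in indep M -> Y \in indep M -> #|X| <= #|Y| ->
  exists Z, [/\ Z \in indep M, X \subset Z, Z \subset X :|: Y & #|Z| = #|Y|].
Proof.
move=> + iY; move: {2}(#|Y| - #|X|) (erefl (#|Y| - #|X|)) => n.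
elim: n X => [|n IHn] X def_n iX leXY.
  exists X; split=> //; first exact: subsetUl.
  by apply/eqP; rewrite eqn_leq leXY -subn_eq0 def_n.
have [|y /setDP[Yy nXy] iyX] := indep_exchange iX iY.
  by rewrite -subn_gt0 def_n.
have cyX : #|y |: X| = #|X|.+1 by rewrite cardsU1 nXy.
have [||Z [iZ syXZ sZ cZ]] := IHn (y |: X) _ iyX.
- by rewrite cyX subnS def_n.
- by rewrite cyX -subn_gt0 def_n.
exists Z; split=> //; first exact: subset_trans (subsetUr _ _) syXZ.
apply: subset_trans sZ _; rewrite !subUset sub1set inE Yy orbT.
by rewrite subsetUl subsetUr.
Qed.

(** For independent [S] this says that [S :&: U] is a basis of [U]. Stated by cardinality, it passes
    to any set meeting [U] in as many elements. *)
Definition spans_within S U :=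
  forall I, I \subset U -> I \in indep M -> #|I| <= #|S :&: U|.

(** A larger independent subset of [U] would supply [y] in [U] outside [S] with [y |: S :&: U]
    independent. Extended inside [y |: S] to size [#|S|], this set becomes [y |: (S :\ x)] with [x]
    outside [U], against the exchange hypothesis; if [S] lies in [U], it is already [y |: S]. *)
Lemma spans_withinP S U :
  S \in indep M ->
  (forall y, y \in U -> y \notin S -> y |: S \notin indep M) ->
  (forall x y, x \in S -> y \in U -> y \notin S ->
     y |: (S :\ x) \in indep M -> x \in U) ->
  spans_within S U.
Proof.
move=> iS noadd noexch I sIU iI; rewrite leqNgt; apply/negP => ltSI.
have iSU : S :&: U \in indep M by apply: indepS iS; exact: subsetIl.
have [y /setDP[Iy nSUy] iy] := indep_exchange iSU iI ltSI.
have Uy := subsetP sIU y Iy.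
have nSy : y \notin S by move: nSUy; rewrite inE Uy andbT.
have cy : #|y |: S :&: U| = #|S :&: U|.+1 by rewrite cardsU1 nSUy.
have [eqSU|ltSU] : #|S :&: U| = #|S| \/ #|S :&: U| < #|S|.
  by apply/predU1P; rewrite -leq_eqVlt subset_leq_card ?subsetIl.
  have defSU : S :&: U = S by apply/eqP; rewrite eqEcard subsetIl eqSU leqnn.
  by have := noadd y Uy nSy; rewrite -defSU iy.
have [|Z [iZ syZ sZ cZ]] := indep_extend iy iS; first by rewrite cy.
have Zy : y \in Z by apply: (subsetP syZ); rewrite setU11.
have sZyS : Z \subset y |: S.
  by apply: subset_trans sZ _; rewrite -setUA setUS // subUset subsetIl subxx.
have cyS : #|y |: S| = #|S|.+1 by rewrite cardsU1 nSy.
have /set0Pn[x] : (y |: S) :\: Z != set0.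
  by rewrite -card_gt0 cardsD (setIidPr sZyS) subn_gt0 cyS cZ.
rewrite in_setD in_setU1 => /andP[nZx].
case: eqVneq => [eqxy | nxy /= Sx]; first by rewrite eqxy Zy in nZx.
have Ux : x \in U.
  apply: (noexch x y) => //; suff -> : y |: (S :\ x) = Z by [].
  apply/esym/eqP; rewrite eqEcard; apply/andP; split.
    apply/subsetP=> z Zz; have := subsetP sZyS z Zz; rewrite !inE.
    by case: eqVneq => //= _ ->; rewrite andbT; apply: contraNneq nZx => <-.
  by rewrite cardsU1 !inE (negPf nSy) andbF cZ (cardsD1 x S) Sx.
by move/negP: nZx; apply; apply: (subsetP syZ); rewrite !inE Sx Ux orbT.
Qed.

(** Extend [S :&: U] by elements of [X] to size [#|X|]. Nothing is gained inside [U], where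
    [S :&: U] is maximum, so by counting all of [X :\: U] is taken. *)
Lemma indep_swap S U X :
  S \in indep M -> spans_within S U -> X \in indep M ->
  #|X :&: U| = #|S :&: U| -> (X :\: U) :|: (S :&: U) \in indep M.
Proof.
move=> iS spS iX cXU.
have iSU : S :&: U \in indep M by apply: indepS iS; exact: subsetIl.
have [|Z [iZ sSZ sZ cZ]] := indep_extend iSU iX.
  by rewrite -cXU subset_leq_card // subsetIl.
suff -> : (X :\: U) :|: (S :&: U) = Z by [].
have ZU : Z :&: U = S :&: U.
  apply/esym/eqP; rewrite eqEcard subsetI sSZ subsetIr /=.
  by apply: spS; [exact: subsetIr | apply: indepS iZ; exact: subsetIl].
rewrite -(setID Z U) ZU setUC; congr (_ :|: _); apply/esym/eqP.
rewrite eqEcard; apply/andP; split.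
  apply/subsetP=> z /setDP[Zz nUz]; have := subsetP sZ z Zz.
  by rewrite !inE (negPf nUz) andbF.
by rewrite !cardsD ZU cXU cZ.
Qed.

Section Exchange.

Variables (S T U : {set V}).
Hypotheses (spS : spans_within S U) (cTU : #|T :&: U| = #|S :&: U|).

(** For [y] in [U], the set [y |: (T :&: U)] would be an independent subset of [U] with more than
    [#|S :&: U|] elements. *)
Lemma add_notin_span y : y \notin T -> y |: T \in indep M -> y \notin U.
Proof.
move=> nTy iyT; apply/negP => Uy.
have /spS : (y |: T) :&: U \subset U by exact: subsetIr.
have -> : (y |: T) :&: U = y |: (T :&: U).
  by rewrite setIUl (setIidPl _) // sub1set.
rewrite cardsU1 inE (negPf nTy) cTU /= add1n ltnn => /(_ _)/negP[] //.
by apply: indepS iyT; rewrite setUS // subsetIl.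
Qed.

(** If [x] were outside [U], removing it would leave [T :&: U] intact, and [y] would enlarge it as
    in [add_notin_span]. *)
Lemma exchange_in_span x y :
  y \notin T -> y |: (T :\ x) \in indep M -> y \in U -> x \in U.
Proof.
move=> nTy iyT Uy; case: (boolP (x \in U)) => // nUx.
have /spS : y |: (T :&: U) \subset U by rewrite subUset sub1set Uy subsetIr.
rewrite cardsU1 inE (negPf nTy) cTU /= add1n ltnn => /(_ _)/negP[] //.
apply: indepS iyT; rewrite setUS //; apply/subsetP=> z /setIP[Tz Uz].
by rewrite !inE Tz andbT; apply: contraNneq nUx => <-.
Qed.

Lemma indep_add y Z : S \in indep M -> y \notin U -> y |: T \in indep M ->
  Z :&: U \subset S -> Z :\: U \subset y |: T -> Z \in indep M.
Proof.
move=> iS nUy iyT sZU sZD.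
have cX : #|(y |: T) :&: U| = #|S :&: U|.
  rewrite -cTU setIUl; suff -> : [set y] :&: U = set0 by rewrite set0U.
  by apply/eqP; rewrite setI_eq0 disjoints1.
apply: indepS (indep_swap iS spS iyT cX).
apply/subsetP=> z Zz; rewrite in_setU in_setD in_setI.
case: (boolP (z \in U)) => Uz /=.
  by rewrite (subsetP sZU) // inE Zz.
by rewrite andbF orbF (subsetP sZD) // inE Uz.
Qed.

End Exchange.

(** Two swaps. The first replaces the part of [T - x + y] inside [W] by that of [S]; the result [X']
    still meets [U] in [#|S :&: U|] elements, hence spans [U]. The second puts [X' :&: U] into [S].
    What remains is [S] off the layer [U :\: W] and [T - x + y] on it. *)
Lemma indep_exchange_layer S T U W x y Z :
  S \in indep M -> W \subset U ->
  spans_within S U -> #|T :&: U| = #|S :&: U| ->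
  spans_within S W -> #|T :&: W| = #|S :&: W| ->
  x \in T -> y \notin T -> x \in U :\: W -> y \in U :\: W ->
  y |: (T :\ x) \in indep M ->
  Z :\: (U :\: W) \subset S -> Z :&: (U :\: W) \subset y |: (T :\ x) -> Z \in indep M.
Proof.
move=> iS sWU spU cU spW cW Tx nTy /setDP[Ux nWx] /setDP[Uy nWy].
set X := y |: (T :\ x) => iX sZS sZL.
have XW : X :&: W = T :&: W.
  apply/setP=> z; rewrite !inE; case: (boolP (z \in W)) => Wz; rewrite ?andbF //.
  have -> : (z == y) = false by apply: contraNF nWy => /eqP<-.
  by have -> : (z == x) = false by apply: contraNF nWx => /eqP<-.
have cX : #|X :&: U| = #|T :&: U|.
  have -> : X :&: U = y |: ((T :&: U) :\ x).
    by apply/setP=> z; rewrite !inE; case: (eqVneq z y) => [->|] //=; rewrite andbA.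
  rewrite cardsU1 !inE (negPf nTy) andbF /= (cardsD1 x (T :&: U)).
  by rewrite inE Tx Ux.
have iX' : (X :\: W) :|: (S :&: W) \in indep M.
  by apply: indep_swap; rewrite // XW.
set X' := _ :|: _ in iX'.
have cX' : #|X' :&: U| = #|S :&: U|.
  have -> : X' :&: U = ((X :&: U) :\: W) :|: (S :&: W).
    apply/setP=> z; rewrite !inE; have := subsetP sWU z.
    by case: (z \in W) => [/(_ isT)->|_] /=; rewrite ?andbT ?andbF ?orbF.
  rewrite cardsU; have -> : (X :&: U :\: W) :&: (S :&: W) = set0.
    by apply/setP=> z; rewrite !inE; case: (z \in W); rewrite ?andbF.
  rewrite cards0 subn0 -cU -cX -(cardsID W (X :&: U)) -setIA (setIidPr sWU).
  by rewrite XW cW addnC.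
have spX' : spans_within X' U by move=> I sIU iI; rewrite cX'; apply: spU.
apply: indepS (indep_swap iX' spX' iS (esym cX')).
apply/subsetP=> z Zz; rewrite in_setU in_setD in_setI.
case: (boolP (z \in U)) => Uz /=; last first.
  by rewrite andbF orbF (subsetP sZS) // !inE (negPf Uz) andbF.
rewrite andbT in_setU in_setD in_setI.
case: (boolP (z \in W)) => Wz /=.
  by rewrite andbT (subsetP sZS) // !inE Wz.
by rewrite andbF orbF (subsetP sZL) // !inE Zz Wz.
Qed.

End Matroid.

(** * Shortening walks to simple paths *)

Section Walks.

Variables (X : finType) (e : rel X).

Lemma has_pathP u v n :
  reflect (exists p, [/\ size p = n, path e u p, uniq (u :: p) & last u p = v])
          (has_path e u v n).
Proof.
apply: (iffP existsP) => [[p /and3P[ep Up /eqP lp]] | [p [sp ep Up lp]]].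
  by exists p; rewrite size_tuple.
by exists (tcast sp (in_tuple p)); rewrite val_tcast ep Up lp eqxx.
Qed.

Lemma has_path_lt_card u v n : has_path e u v n -> n < #|X|.
Proof.
case/has_pathP=> p [<- _ Up _].
by rewrite -[_ < _]/(size (u :: p) <= _) -(card_uniqP Up) max_card.
Qed.

Lemma has_path_of_walk u p :
  path e u p -> exists2 m, m <= size p & has_path e u (last u p) m.
Proof.
case/shortenP=> q eq Uq sqp.
exists (size q); last by apply/has_pathP; exists q.
by apply: uniq_leq_size => //; case/andP: Uq.
Qed.

(** The arc may lead back to a vertex of the path; shortening then makes the length drop, hence the
    inequality. *)
Lemma has_path_arc u v w n :
  has_path e u v n -> e v w -> exists2 m, m <= n.+1 & has_path e u w m.
Proof.
case/has_pathP=> p [<- ep _ <-] evw.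
have [|m] := @has_path_of_walk u (rcons p w); first by rewrite rcons_path ep.
by rewrite size_rcons last_rcons; exists m.
Qed.

End Walks.

(** * Distance from the source and the sets spanned by [S] *)

Section Level.

Variables (V : finType) (M1 M2 : matroid V) (S : {set V}).
Let e := exchange_graph M1 M2 S.
Let N := #|xvertex V|.

Lemma arc_from_in x y : x \in S -> e (inl x) (inl y) ->
  y \notin S /\ y |: (S :\ x) \in indep M1.
Proof. by rewrite /e /= => -> /=; rewrite andbF orbF => /andP. Qed.

Lemma arc_from_notin x y : x \notin S -> e (inl x) (inl y) ->
  y \in S /\ x |: (S :\ y) \in indep M2.
Proof. by rewrite /e /= => nSx; rewrite (negPf nSx) /= => /andP. Qed.

Lemma arc_parity x y : e (inl x) (inl y) -> (y \notin S) = (x \in S).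
Proof.
case: (boolP (x \in S)) => Sx; first by case/(arc_from_in Sx).
by case/(arc_from_notin Sx) => ->.
Qed.

Lemma odd_path p v : path e src p -> last src p = inl v ->
  odd (size p) = (v \notin S).
Proof.
elim/last_ind: p v => // p x IHp v; rewrite rcons_path last_rcons size_rcons.
case/andP=> ep exv def_x; move: exv; rewrite {}def_x.
case def_u: (last src p) => [u|[]] // exv.
  by rewrite (arc_parity exv) /= (IHp u) // negbK.
(* The vertex before [v] is the source, which no arc enters. *)
have -> : p = [::].
  case/lastP: p ep def_u {IHp} => // p y; rewrite rcons_path last_rcons.
  by move=> /andP[_ + def_y]; rewrite def_y; case: (last _ p) => [?|[]].
by case/andP: exv.
Qed.

(* Unreachable elements get a value exceeding all distances, of the parity
   that the side of the bipartition prescribes. *)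
Definition level v :=
  find (has_path e src (inl v : xvertex V)) (iota 0 (2 * N + (v \notin S))).

Lemma level_max v : level v <= 2 * N + (v \notin S).
Proof. by rewrite -[leqRHS](size_iota 0) find_size. Qed.

Lemma has_path_level v : level v < 2 * N + (v \notin S) ->
  has_path e src (inl v : xvertex V) (level v).
Proof.
move=> lt_v; have /(nth_find 0) : has (has_path e src (inl v : xvertex V))
  (iota 0 (2 * N + (v \notin S))) by rewrite has_find size_iota.
by rewrite -/(level v) nth_iota.
Qed.

Lemma level_le v n : has_path e src (inl v : xvertex V) n -> level v <= n.
Proof.
move=> pn; have ltnN := has_path_lt_card pn.
rewrite leqNgt; apply/negP => lt_n; have := before_find 0 lt_n.
rewrite nth_iota ?pn //; by move: ltnN; rewrite -/N; clear; lia.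
Qed.

Lemma odd_level v : odd (level v) = (v \notin S).
Proof.
have := level_max v; rewrite leq_eqVlt => /predU1P[->|/has_path_level].
  by rewrite oddD oddM /= oddb.
by case/has_pathP=> p [<- ep _ lp]; apply: odd_path lp.
Qed.

Lemma level_at_dist v n :
  at_dist e src (inl v : xvertex V) n -> level v = n.
Proof.
case/andP=> pn /forallP npn; apply/eqP; rewrite eqn_leq level_le //=.
have ltnN : n < N by exact: has_path_lt_card pn.
rewrite leqNgt; apply/negP => lt_n; have /negP[] := npn (Ordinal lt_n).
by apply: has_path_level; move: ltnN lt_n; clear; lia.
Qed.

(** The bound on [n] separates true distances from the value given to unreachable elements, which is
    at least [2 * N]. *)
Lemma mem_dlayer v n : n < 2 * N -> level v = n -> v \in dlayer M1 M2 S n.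
Proof.
move=> ltn def_n; rewrite inE /at_dist -{1}def_n has_path_level; last first.
  by rewrite def_n; move: ltn; clear; lia.
apply/forallP=> m; apply/negP => /level_le; rewrite def_n leqNgt.
by rewrite ltn_ord.
Qed.

Lemma level_src v : e src (inl v) -> level v <= 1.
Proof.
move=> ev; apply: level_le; apply/has_pathP; exists [:: inl v].
by rewrite /= andbT; split.
Qed.

Lemma level_arc u v : e (inl u) (inl v) -> level v <= (level u).+1.
Proof.
move=> euv; have := level_max u; rewrite leq_eqVlt => /predU1P[->|ltu].
  (* For [u] at its default value, at least [2 * N], the bound [2 * N + 1] on every level
     suffices. *)
  by apply: leq_trans (level_max v) _; clear; lia.
have [m lem /level_le lev] := has_path_arc (has_path_level ltu) euv.
exact: leq_trans lev lem.
Qed.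

Lemma level_snk v n : at_dist e src snk n -> e (inl v) snk ->
  n <= (level v).+1.
Proof.
case/andP=> /has_path_lt_card ltnN /forallP npn ev.
have := level_max v; rewrite leq_eqVlt => /predU1P[->|ltv].
  by rewrite -/N in ltnN; move: ltnN; clear; lia.
have [m lem pm] := has_path_arc (has_path_level ltv) ev.
apply: leq_trans lem; rewrite leqNgt; apply/negP=> ltmn.
by have /negP[] := npn (Ordinal ltmn).
Qed.

Hypotheses (iS1 : S \in indep M1) (iS2 : S \in indep M2).

Lemma spans_within_above n : ~~ odd n -> 0 < n ->
  spans_within M1 S [set v | n <= level v].
Proof.
move=> n_even n_gt0; apply: spans_withinP => // [y|x y].
  rewrite inE => le_n nSy; apply/negP => iy.
  have : level y <= 1 by apply: level_src; rewrite /e /= nSy.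
  by move: n_even n_gt0 le_n; clear; lia.
move=> Sx; rewrite !inE => le_n nSy iy.
have : level y <= (level x).+1 by apply: level_arc; rewrite /e /= Sx nSy iy.
(* The arc alone gives [n - 1 <= level x]; parity closes the gap of one. *)
have := odd_level x; have := odd_level y; rewrite Sx nSy /=.
by move: n_even n_gt0 le_n; clear; lia.
Qed.

Lemma spans_within_below m n : at_dist e src snk m -> ~~ odd n -> n.+1 < m ->
  spans_within M2 S [set v | level v <= n].
Proof.
move=> dist_m n_even n_lt; apply: spans_withinP => // [y|x y].
  rewrite inE => le_n nSy; apply/negP => iy.
  have : m <= (level y).+1 by apply: level_snk; rewrite /e /= ?nSy.
  by move: n_lt le_n; clear; lia.
move=> Sx; rewrite !inE => le_n nSy iy.
have : level x <= (level y).+1.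
  by apply: level_arc; rewrite /e /= Sx nSy iy orbT.
have := odd_level x; have := odd_level y; rewrite Sx nSy /=.
by move: n_even le_n; clear; lia.
Qed.

End Level.

(** Each inner vertex has an arc entering it and an arc leaving it, so it is neither the source nor
    the sink. Indexing by [nat] keeps later index arithmetic plain; past the path [f] takes the junk
    value [x0]. *)
Lemma walk_src_snk (V : finType) (M1 M2 : matroid V) (T : {set V}) n :
  has_path (exchange_graph M1 M2 T) src snk n.+2 ->
  exists f : nat -> V,
    [/\ exchange_graph M1 M2 T src (inl (f 0)),
        forall i, i < n -> exchange_graph M1 M2 T (inl (f i)) (inl (f i.+1))
      & exchange_graph M1 M2 T (inl (f n)) snk].
Proof.
set e := exchange_graph _ _ _; case/has_pathP=> p [sp ep _ lp].
have arc i : i < n.+2 -> e (nth snk (src :: p) i) (nth snk p i).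
  by rewrite -sp => /(pathP snk ep).
have inner i : i < n.+1 -> {x | nth snk p i = inl x}.
  move=> lti; have := arc i (ltnW lti); have := arc i.+1 lti; rewrite /=.
  case: (nth snk p i) => [x _ _|[]]; first by exists x.
    by move=> H; exfalso; move: H; rewrite /e; case: (nth _ _ _) => [?|[]].
  by move=> _ H; exfalso; move: H; rewrite /e; case: i lti => [|i] _ /=;
     last case: (nth _ _ _) => [?|[]].
have [x0 _] := inner 0 isT.
pose f i := if nth snk p i is inl x then x else x0.
have fE i : i < n.+1 -> nth snk p i = inl (f i).
  by move/inner=> [x def_x]; rewrite /f def_x.
exists f; split=> [|i lti|].
- by rewrite -fE //; exact: (arc 0).
- rewrite -!fE //; last by rewrite ltnW.
  by apply: (arc i.+1); rewrite !ltnS ltnW.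
have def_snk : nth snk p n.+1 = snk by rewrite -{2}lp (last_nth snk) sp.
by have := arc n.+1 (ltnSn _); rewrite def_snk /= fE.
Qed.

(** * Levels and cardinalities after augmentation *)

Section Augmentation.

Variables (V : finType) (M1 M2 : matroid V) (S : {set V}) (l : nat).
Variable P : set_sequence V l.
Hypotheses (iS1 : S \in indep M1) (iS2 : S \in indep M2).
Hypothesis dist_t : at_dist (exchange_graph M1 M2 S) src snk (2 * l.+1).
Hypothesis augP : augmenting_set M1 M2 S P.

Let T := augment S P.
Let eT := exchange_graph M1 M2 T.
Let lev := level M1 M2 S.
Let U n := [set v | n <= lev v].
Let W n := [set v | lev v <= n].

Lemma level_setA k v : v \in setA P k -> lev v = 2 * k.+1.
Proof.
by move/(subsetP (aug_layerA augP k)); rewrite inE; apply: level_at_dist.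
Qed.

Lemma level_setB k v : v \in setB P k -> lev v = (2 * k).+1.
Proof.
move/(subsetP (aug_layerB augP k)); rewrite inE => /level_at_dist.
by rewrite -/(lev v) => ->; clear; lia.
Qed.

Lemma mem_of_even v n : lev v = 2 * n -> v \in S.
Proof.
by move=> lv; apply: negbFE; rewrite -(odd_level M1 M2) -/(lev v) lv oddM.
Qed.

Lemma notin_of_odd v n : lev v = (2 * n).+1 -> v \notin S.
Proof. by move=> lv; rewrite -(odd_level M1 M2) -/(lev v) lv /= oddM. Qed.

Lemma setB_sub_augment k : setB P k \subset T.
Proof. by apply: subsetU; rewrite (bigcup_sup k) ?orbT. Qed.

Lemma setA_notin_augment k v : v \in setA P k -> v \notin T.
Proof.
move=> Av; rewrite !inE negb_or; apply/andP; split.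
  by rewrite negb_and negbK; apply/orP; left; apply/bigcupP; exists k.
apply/bigcupP=> -[j _ /level_setB/notin_of_odd]; apply/negP; rewrite negbK.
exact: mem_of_even (level_setA Av).
Qed.

Lemma mem_augment v :
  v \in S -> (forall k : 'I_l, v \notin setA P k) -> v \in T.
Proof.
move=> Sv nAv; rewrite !inE Sv andbT; apply/orP; left.
by apply/bigcupP=> -[k _ Ak]; have := nAv k; rewrite Ak.
Qed.

(** The [setA P k] lie in [S], the [setB P k] outside it, and distinct indices have distinct levels,
    so all unions are disjoint. The removed elements are counted on the left to avoid truncated
    subtraction. *)
Lemma card_augmentI D :
  #|T :&: D| + \sum_k #|setA P k :&: D| = #|S :&: D| + \sum_k #|setB P k :&: D|.
Proof.
have disjA j k : j != k -> [disjoint setA P j :&: D & setA P k :&: D].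
  move=> njk; rewrite -setI_eq0; apply/eqP/setP=> v; rewrite !inE.
  apply/negP=> /andP[/andP[/level_setA lj _] /andP[/level_setA lk _]].
  by move/negP: njk; apply; rewrite -val_eqE /=; move: lj lk; clear; lia.
have disjB j k : j != k -> [disjoint setB P j :&: D & setB P k :&: D].
  move=> njk; rewrite -setI_eq0; apply/eqP/setP=> v; rewrite !inE.
  apply/negP=> /andP[/andP[/level_setB lj _] /andP[/level_setB lk _]].
  by move/negP: njk; apply; rewrite -val_eqE /=; move: lj lk; clear; lia.
have -> : \sum_k #|setA P k :&: D| = #|\bigcup_k (setA P k :&: D)|.
  rewrite -sum1_card partition_disjoint_bigcup //.
  by apply: eq_bigr => k _; rewrite sum1_card.
have -> : \sum_k #|setB P k :&: D| = #|\bigcup_k (setB P k :&: D)|.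
  rewrite -sum1_card partition_disjoint_bigcup //.
  by apply: eq_bigr => k _; rewrite sum1_card.
set A := \bigcup_k (setA P k :&: D); set B := \bigcup_k (setB P k :&: D).
have sAS : A \subset S :&: D.
  apply/bigcupsP=> k _; apply: setSI; apply/subsetP=> v /level_setA.
  exact: mem_of_even.
have -> : T :&: D = ((S :&: D) :\: A) :|: B.
  rewrite /A /B -!big_distrl /= /T /augment; apply/setP=> v; rewrite !inE.
  by case: (v \in D); rewrite ?andbT ?andbF.
have SB0 : S :&: B = set0.
  apply/setP=> v; rewrite in_setI in_set0; apply/negP=> /andP[Sv].
  case/bigcupP=> k _ /setIP[/level_setB/notin_of_odd]; by rewrite Sv.
have disjSB : ((S :&: D) :\: A) :&: B = set0.
  apply/eqP; rewrite -subset0 -SB0; apply: setSI.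
  by apply: subset_trans (subsetDl _ _) (subsetIl _ _).
rewrite cardsU disjSB cards0 subn0 addnAC; congr (_ + _).
by rewrite -(cardsID A (S :&: D)) (setIidPr sAS) addnC.
Qed.

(** Each set of [P] lies in a single level, so a threshold set contains it or misses it; the factor
    [b] treats both cases at once. *)
Lemma card_setI_const (A D : {set V}) b :
  (forall v, v \in A -> (v \in D) = b) -> #|A :&: D| = b * #|A|.
Proof.
case: b => AD; last first.
  rewrite mul0n; apply/eqP; rewrite cards_eq0 setI_eq0 disjoints_subset.
  by apply/subsetP=> v Av; rewrite inE AD.
by rewrite mul1n; congr #|pred_of_set _|; apply/setIidPl/subsetP=> v /AD.
Qed.

(** Pair [setA P k], at level [2 * k + 2], with the next B-set, one level higher: an even threshold
    does not separate them. The unpaired first B-set is at level 1, outside [U n]. *)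
Lemma card_augment_above n : ~~ odd n -> 0 < n -> #|T :&: U n| = #|S :&: U n|.
Proof.
move=> n_even n_gt0; have [w [cA cB]] := aug_width augP.
apply/eqP; rewrite -(eqn_add2r (\sum_k #|setA P k :&: U n|)) card_augmentI.
rewrite eqn_add2l big_ord_recl (@card_setI_const _ _ false) ?mul0n ?add0n.
  apply/eqP/eq_bigr => k _; pose b := n <= 2 * k.+1.
  rewrite !(@card_setI_const _ _ b) ?cA ?cB // => v.
    by move/level_setA; rewrite inE => ->.
  move/level_setB; rewrite inE /= /bump /= => ->; rewrite /b.
  by move: n_even n_gt0; clear; lia.
move=> v /level_setB; rewrite inE => -> /=.
by move: n_even n_gt0; clear; lia.
Qed.

(** Here [setA P k] is paired with [setB P k], one level lower; the unpaired last B-set is at level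
    [2 * l + 1], outside [W n]. *)
Lemma card_augment_below n : ~~ odd n -> n <= 2 * l ->
  #|T :&: W n| = #|S :&: W n|.
Proof.
move=> n_even le_n; have [w [cA cB]] := aug_width augP.
apply/eqP; rewrite -(eqn_add2r (\sum_k #|setA P k :&: W n|)) card_augmentI.
rewrite eqn_add2l big_ord_recr /= (@card_setI_const _ _ false) ?mul0n ?addn0.
  apply/eqP/eq_bigr => k _; pose b := 2 * k.+1 <= n.
  rewrite !(@card_setI_const _ _ b) ?cA ?cB // => v.
    by move/level_setA; rewrite inE => ->.
  move/level_setB; rewrite inE /= => ->; rewrite /b.
  by move: n_even; clear; lia.
move=> v /level_setB; rewrite inE => -> /=.
by move: le_n; clear; lia.
Qed.

Lemma spans_within_U n : ~~ odd n -> 0 < n -> spans_within M1 S (U n).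
Proof. exact: spans_within_above. Qed.

Lemma spans_within_W n : ~~ odd n -> n <= 2 * l -> spans_within M2 S (W n).
Proof.
move=> n_even le_n; apply: spans_within_below dist_t n_even _ => //.
by move: le_n; clear; lia.
Qed.

(** * A path in the new exchange graph and the augmenting set it enlarges *)

Section Walk.

Variable f : nat -> V.
Hypotheses (f_src : eT src (inl (f 0))) (f_snk : eT (inl (f (2 * l))) snk).
Hypothesis f_arc : forall i, i < 2 * l -> eT (inl (f i)) (inl (f i.+1)).

Lemma walk_mem i : i <= 2 * l -> (f i \in T) = odd i.
Proof.
elim: i => [_|i IHi lti]; first by case/andP: f_src => /negPf.
have /= := arc_parity (f_arc lti); rewrite (IHi (ltnW lti)) => <-.
by rewrite negbK.
Qed.

Lemma walk_arc1 i : i < 2 * l -> odd i ->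
  f i.+1 |: (T :\ f i) \in indep M1.
Proof.
move=> lti i_odd.
by case: (@arc_from_in _ _ _ _ _ _ _ (f_arc lti)); rewrite // walk_mem // ltnW.
Qed.

Lemma walk_arc2 i : i < 2 * l -> ~~ odd i ->
  f i |: (T :\ f i.+1) \in indep M2.
Proof.
move=> lti i_even; case: (@arc_from_notin _ _ _ _ _ _ _ (f_arc lti)) => //.
by rewrite walk_mem // ltnW.
Qed.

(** Induction from the source. At odd [i] the arc is of [M1] and cannot enter [U i.+3] from outside;
    at even [i] it is of [M2] and cannot leave [W i.+2]. *)
Lemma walk_level_le i : i <= 2 * l -> lev (f i) <= i.+1.
Proof.
elim: i => [_|i IHi lti].
  case/andP: f_src => nT i1.
  have := add_notin_span (@spans_within_U 2 isT isT)
    (@card_augment_above 2 isT isT) nT i1.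
  by rewrite inE -ltnNge.
have {}IHi := IHi (ltnW lti); case: (boolP (odd i)) => odd_i.
  have e3 : ~~ odd i.+3 by rewrite /= odd_i.
  have nT : f i.+1 \notin T by rewrite walk_mem //= odd_i.
  have := exchange_in_span (spans_within_U e3 isT) (card_augment_above e3 isT) nT
    (walk_arc1 lti odd_i).
  rewrite !inE -/(lev _) -/(lev _) => H; rewrite leqNgt; apply/negP=> /H.
  by move: IHi; clear; lia.
have e2 : ~~ odd i.+2 by rewrite /= negbK.
have le2 : i.+2 <= 2 * l by move: lti odd_i; clear; lia.
have nT : f i \notin T by rewrite walk_mem // ltnW.
have := exchange_in_span (spans_within_W e2 le2) (card_augment_below e2 le2) nT
    (walk_arc2 lti odd_i).
by rewrite !inE; apply; rewrite ltnW.
Qed.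

(** The mirror induction from the sink, with [j] the number of arcs back from [f (2 * l)]. It uses
    [U i.+1] at odd [i] and [W i] at even [i]. *)
Lemma walk_level_ge j : j <= 2 * l -> (2 * l - j).+1 <= lev (f (2 * l - j)).
Proof.
elim: j => [_|j IHj ltj].
  have e2 : ~~ odd (2 * l) by rewrite oddM.
  rewrite subn0; case/andP: f_snk => nT i2.
  have := add_notin_span (spans_within_W e2 (leqnn _))
    (card_augment_below e2 (leqnn _)) nT i2.
  by rewrite inE -ltnNge.
move: (IHj (ltnW ltj)); rewrite -(subnSK ltj).
have : 2 * l - j.+1 < 2 * l by move: ltj; clear; lia.
move: (_ - _) => i lti IHi; case: (boolP (odd i)) => odd_i.
  have e1 : ~~ odd i.+1 by rewrite /= odd_i.
  have nT : f i.+1 \notin T by rewrite walk_mem //= odd_i.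
  have := exchange_in_span (spans_within_U e1 isT) (card_augment_above e1 isT) nT
    (walk_arc1 lti odd_i).
  by rewrite !inE; apply; rewrite ltnW.
have nT : f i \notin T by rewrite walk_mem // ltnW.
have lei := ltnW lti.
have := exchange_in_span (spans_within_W odd_i lei)
  (card_augment_below odd_i lei) nT (walk_arc2 lti odd_i).
rewrite !inE => H; rewrite ltnNge; apply/negP=> /H; rewrite -/(lev _).
by move: IHi; clear; lia.
Qed.

Lemma walk_level i : i <= 2 * l -> lev (f i) = i.+1.
Proof.
move=> lei; apply/eqP; rewrite eqn_leq walk_level_le //=.
by have := walk_level_ge (leq_subr i (2 * l)); rewrite subKn.
Qed.

(** With indices from 0, the path vertices b and a of index [k] are [f (2 * k)] and
    [f (2 * k).+1]. *)
Definition extended_sequence :=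
  SetSequence [ffun k : 'I_l.+1 => f (2 * k) |: setB P k]
              [ffun k : 'I_l => f (2 * k).+1 |: setA P k].

Lemma walk_layer i : i <= 2 * l -> f i \in dlayer M1 M2 S i.+1.
Proof.
move=> lei; apply: mem_dlayer; last exact: walk_level.
have /andP[/has_path_lt_card ltN _] := dist_t.
by move: lei ltN; clear; lia.
Qed.

Lemma ord_double (k : 'I_l) : (2 * k).+2 <= 2 * l.
Proof. by have := ltn_ord k; clear; lia. Qed.

Lemma ord_double_le (k : 'I_l.+1) : 2 * k <= 2 * l.
Proof. by rewrite leq_mul2l /= -ltnS. Qed.

Lemma walkB_level (k : 'I_l.+1) v : v \in f (2 * k) |: setB P k ->
  lev v = (2 * k).+1.
Proof.
by case/setU1P => [->|]; [apply/walk_level/ord_double_le | apply: level_setB].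
Qed.

Lemma walkB_mem (k : 'I_l.+1) v : v \in f (2 * k) |: setB P k ->
  v \in f (2 * k) |: T.
Proof. by apply: subsetP; rewrite setUS ?setB_sub_augment. Qed.

(** Among the removed sets only [setA P k] has level [2 * k + 2], so the other elements of [S] in
    [L] survive in [T]. Elements of the B-set have odd level and thus differ from [f (2 * k).+1]. *)
Lemma exchange_target_sub (k : 'I_l) (j : 'I_l.+1) (L : {set V}) :
  (forall v, v \in L -> v \in S -> lev v = (2 * k).+2) ->
  ((S :\: (f (2 * k).+1 |: setA P k)) :|: (f (2 * j) |: setB P j)) :&: L
    \subset f (2 * j) |: (T :\ f (2 * k).+1).
Proof.
move=> levL; apply/subsetP=> v /setIP[/setUP[/setDP[Sv nAv] Lv | Bv _]].
  move: nAv; rewrite in_setU1 negb_or => /andP[nfv nAv].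
  rewrite in_setU1 in_setD1 nfv mem_augment ?orbT // => j'.
  apply: contraNN nAv => Aj; suff -> : k = j' by [].
  apply: val_inj => /=; move: (level_setA Aj); rewrite (levL v Lv Sv).
  by clear; lia.
have := walkB_mem Bv; rewrite !inE => /orP[-> // | ->].
rewrite andbT; apply/orP; right; apply/eqP=> def_v.
have := walkB_level Bv; rewrite def_v walk_level; last exact: ltnW (ord_double k).
by clear; lia.
Qed.

Lemma extended_sequence_augmenting : augmenting_set M1 M2 S extended_sequence.
Proof.
have even_lev v n : lev v = n -> v \in S -> ~~ odd n.
  by move=> <-; rewrite odd_level negbK.
have f_notin (k : 'I_l.+1) : f (2 * k) \notin T.
  by rewrite walk_mem ?ord_double_le // oddM.
have f_in (k : 'I_l) : f (2 * k).+1 \in T.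
  by rewrite walk_mem /= ?oddM //; apply: ltnW (ord_double k).
split=> [k|k||||k|k]; rewrite ?ffunE.
- rewrite subUset sub1set (aug_layerA augP) andbT mulnS.
  exact: walk_layer (ltnW (ord_double k)).
- rewrite subUset sub1set (aug_layerB augP) andbT mulnS /= subn1 /=.
  exact/walk_layer/ord_double_le.
(* Every set gains exactly one element: [f (2 * k).+1] is in [T], which avoids [setA P k], and
   [f (2 * k)] is outside [T], which contains [setB P k]. *)
- have [w [cA cB]] := aug_width augP; exists w.+1; split=> k; rewrite ffunE cardsU1.
    by rewrite cA (contraL (@setA_notin_augment k _)) ?f_in.
  by rewrite cB (contraNN (subsetP (setB_sub_augment k) _)) ?f_notin.
(* Outside [U 2] no element of [S] was removed, since the sets [setA P k] have level at least 2. *)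
- case/andP: f_src => nT i1.
  apply: (indep_add (@spans_within_U 2 isT isT)
    (@card_augment_above 2 isT isT)) i1 _ _ => //.
  + by rewrite inE -ltnNge walk_level.
  + apply/subsetP=> v /setIP[/setUP[// | /walkB_level lv]].
    by rewrite inE lv.
  apply/subsetP=> v /setDP[/setUP[Sv | Bv _]]; last exact: walkB_mem Bv.
  rewrite inE -ltnNge => lt_v.
  rewrite in_setU1 mem_augment ?orbT // => k; apply: contraTN lt_v => /level_setA->.
  by clear; lia.
(* Symmetrically, all the sets [setA P k] lie in [W (2 * l)]. *)
- case/andP: f_snk => nT i2; have e2 : ~~ odd (2 * l) by rewrite oddM.
  apply: (indep_add (spans_within_W e2 (leqnn _))
    (card_augment_below e2 (leqnn _))) i2 _ _ => //.
  + by rewrite inE -ltnNge walk_level.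
  + apply/subsetP=> v /setIP[/setUP[// | /walkB_level lv]].
    by rewrite inE lv; rewrite ltnn.
  apply/subsetP=> v /setDP[/setUP[Sv | Bv _]]; last exact: walkB_mem Bv.
  rewrite inE -ltnNge => lt_v.
  rewrite in_setU1 mem_augment ?orbT // => k; apply: contraTN lt_v => /level_setA->.
  by have := ltn_ord k; clear; lia.
(* The layer consists of levels [2 * k + 2] and [2 * k + 3], those of [setA P k] and [setB P j]. *)
- have lk := ord_double k; set j := lift ord0 k.
  have def_j : 2 * j = (2 * k).+2 by rewrite /= /bump /= mulnS.
  have e2 : ~~ odd (2 * k).+2 by rewrite /= oddM.
  have e4 : ~~ odd (2 * k).+4 by rewrite /= oddM.
  have BL v : v \in f (2 * j) |: setB P j -> v \in U (2 * k).+2 :\: U (2 * k).+4.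
    by move/walkB_level=> lv; rewrite !inE lv def_j; clear; lia.
  apply: (@indep_exchange_layer _ _ S T (U (2 * k).+2) (U (2 * k).+4)
           (f (2 * k).+1) (f (2 * j))) => //.
  + by apply/subsetP=> v; rewrite !inE; apply: leq_trans; rewrite ltnW.
  + exact: spans_within_U.
  + exact: card_augment_above.
  + exact: spans_within_U.
  + exact: card_augment_above.
  + by rewrite !inE walk_level ?(ltnW lk) //; clear; lia.
  + by apply: BL; rewrite setU11.
  + by rewrite def_j; apply: walk_arc1; rewrite //= oddM.
  + apply/subsetP=> v; rewrite in_setD in_setU => /andP[nLv].
    case/orP=> [/setDP[] // | /BL Lv]; by rewrite Lv in nLv.
  apply: exchange_target_sub => v; rewrite !inE => Lv Sv.
  by have := even_lev v _ (erefl _) Sv; move: Lv; clear; lia.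
(* For [M2] the layer consists of levels [2 * k + 1] and [2 * k + 2], those of [setB P j] and
   [setA P k]. *)
have lk := ord_double k; set j := widen_ord _ k.
have def_j : j = k :> nat by [].
have e0 : ~~ odd (2 * k) by rewrite oddM.
have e2 : ~~ odd (2 * k).+2 by rewrite /= oddM.
have l0 : 2 * k <= 2 * l by rewrite ltnW // ltnW.
have BL v : v \in f (2 * j) |: setB P j -> v \in W (2 * k).+2 :\: W (2 * k).
  by move/walkB_level=> lv; rewrite !inE lv def_j; clear; lia.
apply: (@indep_exchange_layer _ _ S T (W (2 * k).+2) (W (2 * k))
         (f (2 * k).+1) (f (2 * j))) => //.
- apply/subsetP=> v; rewrite !inE => le_v; apply: leq_trans le_v _.
  by clear; lia.
- exact: spans_within_W.
- exact: card_augment_below.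
- exact: spans_within_W.
- exact: card_augment_below.
- by rewrite !inE walk_level ?(ltnW lk) //; clear; lia.
- by apply: BL; rewrite setU11.
- by apply: walk_arc2; rewrite // ltnW.
- apply/subsetP=> v; rewrite in_setD in_setU => /andP[nLv].
  case/orP=> [/setDP[] // | /BL Lv]; by rewrite Lv in nLv.
apply: exchange_target_sub => v; rewrite !inE => Lv Sv.
by have := even_lev v _ (erefl _) Sv; move: Lv; clear; lia.
Qed.

End Walk.

End Augmentation.

Theorem theorem6p16 (V : finType) (M1 M2 : matroid V) (S : {set V}) (l : nat)
    (P : set_sequence V l) :
  S \in indep M1 ->
  S \in indep M2 ->
  at_dist (exchange_graph M1 M2 S) src snk (2 * l.+1) ->
  maximal_augmenting_set M1 M2 S P ->
  ~~ has_path (exchange_graph M1 M2 (augment S P)) src snk (2 * l.+1).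
Proof.
move=> iS1 iS2 dist_t [augP maxP]; apply/negP; rewrite mulnS.
case/walk_src_snk=> f [f_src f_arc f_snk].
have augQ := extended_sequence_augmenting iS1 iS2 dist_t augP f_src f_snk f_arc.
have defP : extended_sequence P f = P.
  by apply: maxP augQ _; split=> k; rewrite ffunE subsetUr.
(* By maximality [f 0] already lies in the first B-set, hence in the augmented set, whereas the arc
   from the source needs it outside. *)
have /andP[/negP nT _] := f_src; apply: nT.
apply: (subsetP (setB_sub_augment S P ord0)).
by rewrite -defP ffunE setU11.
Qed.
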